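(* For every integer $t>17$, $\delta_{t,3}(\mathbb{Z}^2)=\delta_{t-1,1}(\mathbb{Z}^2)$.
   Context: $\mathbb{Z}^2$ denotes the infinite grid graph (vertices the integer points of the plane, two vertices adjacent iff they differ by $1$ in exactly one coordinate), so the graph distance is $d(u,v)=|u-v|_1$ (the $\ell_1$ distance). For positive integers $t,r$, a set $\mathcal{T}\subseteq\mathbb{Z}^2$ of ''towers'' is $(t,r)$ broadcasting if every vertex $v\in\mathbb{Z}^2$ satisfies $\sum_{u\in\mathcal{T}}\max\{0,t-d(u,v)\}\ge r$. The density of a set $\mathcal{T}\subseteq\mathbb{Z}^2$ is $\limsup_{n\to\infty}\frac{|\mathcal{T}\cap[-n,n]^2|}{(2n+1)^2}$, and $\delta_{t,r}(\mathbb{Z}^2)$ denotes the minimal density of a $(t,r)$ broadcasting set in $\mathbb{Z}^2$. *)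

(* Defs.v *)
From HB Require Import structures.
From mathcomp Require Import all_boot all_order all_algebra finmap.
From mathcomp Require Import all_classical all_reals all_analysis.
From mathcomp Require Import zify.

Set Implicit Arguments.
Unset Strict Implicit.
Unset Printing Implicit Defensive.
Import Order.TTheory GRing.Theory Num.Theory.

Local Open Scope classical_set_scope.
Local Open Scope ring_scope.

Definition dist (u v : int * int) : int := `|u.1 - v.1| + `|u.2 - v.2|.

(* [\sum_(u \in A) F u] is 0 when F has infinite support on A; here the
   support is finite, see [finite_signal_support]. *)
Definition signal (t : nat) (T : set (int * int)) (v : int * int) : int :=
  \sum_(u \in T) Num.max 0 (t%:Z - dist u v).

Definition broadcasting (t r : nat) (T : set (int * int)) : Prop :=
  forall v : int * int, r%:Z <= signal t T v.

Definition box (n : nat) : set (int * int) :=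
  [set v | - n%:Z <= v.1 <= n%:Z /\ - n%:Z <= v.2 <= n%:Z].

(* [fset_set A] is empty when A is infinite; here it is applied to a subset of
   a box, see [finite_box]. *)
Definition density (R : realType) (T : set (int * int)) : \bar R :=
  limn_esup (fun n : nat =>
    ((#|` fset_set (T `&` box n)|)%:R / ((2 * n + 1) ^ 2)%:R : R)%:E).

(* [is_delta t r d] says that d is the minimum (attained infimum) of the
   densities of (t,r) broadcasting sets, i.e. that delta_{t,r} is d. It is a
   relation, so that no default value is needed should no minimum exist. *)
Definition is_delta (R : realType) (t r : nat) (d : \bar R) : Prop :=
  (exists2 T, broadcasting t r T & density R T = d) /\
  (forall T, broadcasting t r T -> (d <= density R T)%E).

Lemma is_delta_unique (R : realType) (t r : nat) (d d' : \bar R) :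
  is_delta t r d -> is_delta t r d' -> d = d'.
Proof.
move=> [[T bT <-] mT] [[T' bT' <-] mT'].
by apply/eqP; rewrite eq_le mT // mT'.
Qed.

Lemma finite_box (n : nat) : finite_set (box n).
Proof.
pose f (p : nat * nat) : int * int := (p.1%:Z - n%:Z, p.2%:Z - n%:Z).
apply: (@sub_finite_set _ _ (f @` (`I_(2 * n).+1 `*` `I_(2 * n).+1))).
  move=> [x y] [/= /andP[? ?] /andP[? ?]].
  exists (absz (x + n%:Z), absz (y + n%:Z)); first by split => /=; lia.
  by rewrite /f /=; congr pair; lia.
by apply: finite_image; apply: finite_setX; exact: finite_II.
Qed.

Lemma finite_signal_support (t : nat) (T : set (int * int)) (v : int * int) :
  finite_set
    (T `&` (fun u => Num.max 0 (t%:Z - dist u v)) @^-1` [set~ 0]).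
Proof.
apply: sub_finite_set (finite_box (t + absz v.1 + absz v.2)).
by move=> [x y] [_]; case: v => a b; rewrite /dist /box /= => /eqP; lia.
Qed.

(* Main.v *)
Require Import Defs.
From mathcomp Require Import all_boot all_order all_algebra.
From mathcomp Require Import all_classical all_reals all_analysis.
From mathcomp Require Import finmap zify ring.

(* Put [k = t - 2]. Balls of radius [k] tile the plane, the tiling is
   (t - 1, 1) broadcasting, and every (t - 1, 1) broadcasting set is (t, 3)
   broadcasting: a vertex at distance [k] from a tower has a neighbour outside
   its ball, covered by a second tower. So it remains to show that a (t, 3)
   broadcasting set has density at least that of the tiling, i.e. that on
   average a vertex lies in at least one ball of radius [k] around a tower. The
   only loss comes from holes, the vertices in no such ball; a hole [h] has at
   least three towers on the sphere of radius [k + 1] around it. Inspecting the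
   quadrants that contain these towers shows that their balls, or that of
   another tower close to [h], overlap along diagonal lines next to [h] in at
   least [k] points. The hole charges these points. A doubly covered point is
   charged at most 16 times, namely at most once for each combination of a kind
   of charge, a quadrant direction and a side of the diagonal through the hole;
   as [k >= 16], there are at most as many holes as doubly covered points. *)

Set Implicit Arguments.
Unset Strict Implicit.
Unset Printing Implicit Defensive.
Import Order.TTheory GRing.Theory Num.Theory numFieldNormedType.Exports.
Local Open Scope classical_set_scope.
Local Open Scope ring_scope.

(** * Charges of a hole *)

Definition sgb (b : bool) : int := if b then 1 else -1.

(** The signs reflect the axes, so that every quadrant around [h] can be treated like the first. *)
Definition shift_pt (h : int * int) (s t : bool) (i j : int) : int * int :=
  (h.1 + sgb s * i, h.2 + sgb t * j).

Lemma shift_pt_inj (h : int * int) (s t : bool) (i j i' j' : int) :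
  shift_pt h s t i j = shift_pt h s t i' j' -> i = i' /\ j = j'.
Proof. by case=> + +; case: s; case: t; rewrite /sgb => *; split; lia. Qed.

Lemma dist_shift_pt (h : int * int) (s t : bool) (i j i' j' : int) :
  dist (shift_pt h s t i j) (shift_pt h s t i' j') = `|i - i'| + `|j - j'|.
Proof. by case: s t => [] []; rewrite /dist /shift_pt /sgb /=; lia. Qed.

Lemma shift_pt_shift (h h' : int * int) (s t : bool) (i j i' j' : int) :
  shift_pt h s t i j = shift_pt h' s t i' j' ->
  h' = shift_pt h s t (i - i') (j - j').
Proof.
case: h h' => [x y] [x' y']; rewrite /shift_pt /=.
by case: s t => [] [] /=; rewrite /sgb => -[? ?]; congr pair; lia.
Qed.

Lemma shift_pt_add (h : int * int) (s t : bool) (i j i' j' : int) :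
  shift_pt (shift_pt h s t i j) s t i' j' = shift_pt h s t (i + i') (j + j').
Proof.
case: h => [x y]; rewrite /shift_pt /=.
by case: s t => [] [] /=; rewrite /sgb; congr pair; lia.
Qed.

Lemma shift_ptNr (h : int * int) (s t : bool) (i j : int) :
  shift_pt h s (~~ t) i j = shift_pt h s t i (- j).
Proof. by case: t; rewrite /shift_pt /sgb /=; congr pair; lia. Qed.

Lemma shift_ptNl (h : int * int) (s t : bool) (i j : int) :
  shift_pt h (~~ s) t i j = shift_pt h s t (- i) j.
Proof. by case: s; rewrite /shift_pt /sgb /=; congr pair; lia. Qed.

Lemma shift_ptP (h u : int * int) (s t : bool) :
  u = shift_pt h s t (sgb s * (u.1 - h.1)) (sgb t * (u.2 - h.2)).
Proof. by case: s t u => [] [] [x y]; rewrite /shift_pt /sgb /=; congr pair; lia. Qed.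

Definition hole (k : nat) (T : set (int * int)) (h : int * int) : Prop :=
  forall u, T u -> k%:Z < dist u h.

Definition doubly (k : nat) (T : set (int * int)) (v : int * int) : Prop :=
  exists u u', [/\ T u, T u', u != u', dist u v <= k%:Z & dist u' v <= k%:Z].

(* The sphere of radius [k + 1] around [h] has four open quadrants, given by the
   signs [s] and [t], and four corners on the axes, each belonging to two of
   the closed quadrants. *)
Definition inner (k : nat) (T : set (int * int)) (h : int * int) (s t : bool) :
    Prop :=
  exists a b : int, [/\ 0 < a, 0 < b, a + b = k%:Z + 1 & T (shift_pt h s t a b)].

Definition crowded (k : nat) (T : set (int * int)) (h : int * int)
    (s t : bool) : Prop :=
  exists a b a' b' : int,
    [/\ [/\ 0 < a, 0 < b, a + b = k%:Z + 1 & T (shift_pt h s t a b)],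
        [/\ 0 <= a', 0 <= b', a' + b' = k%:Z + 1 & T (shift_pt h s t a' b')]
      & a != a'].

Definition anchored (k : nat) (T : set (int * int)) (h : int * int)
    (s t : bool) : Prop :=
  let e := T (shift_pt h s t (k%:Z + 1) 0) in
  let n := T (shift_pt h s t 0 (k%:Z + 1)) in
  (e \/ n) /\ (e /\ n \/ inner k T h (~~ s) (~~ t)).

Definition inner_charge (k : nat) (T : set (int * int)) (h v : int * int)
    (s t o : bool) : Prop :=
  inner k T h s t /\
  exists i j : int, [/\ v = shift_pt h s t i j, `|i - j| <= 1,
    0 < i + j <= 2 * k%:Z + 1 & o = (i - j == 1)].

Definition corner_charge (k : nat) (T : set (int * int)) (h v : int * int)
    (s t o : bool) : Prop :=
  [/\ forall s' t', ~ crowded k T h s' t', anchored k T h s t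
    & exists2 m : nat, (m < k)%N
      & v = shift_pt h s t (m%:Z + 1 + o%:Z) (m%:Z + 1 + (~~ o)%:Z)].

(* The label [(c, (s, t), o)] records the kind of charge, the quadrant into
   which the point is reached, and the side [o] of the diagonal; a point on the
   diagonal itself counts with the side [o = false]. *)
Definition charges (k : nat) (T : set (int * int)) (h : int * int)
    (x : (int * int) * (bool * (bool * bool) * bool)) : Prop :=
  let: (v, (c, (s, t), o)) := x in
  if c then inner_charge k T h v s t o else corner_charge k T h v s t o.

(** If [i + j] is the same for both holes, its parity and the side [o] determine [i - j]. Otherwise
    one hole lies ahead of the other along the diagonal, at distance at most [2 * k], and the inner
    tower of the hole behind covers it. *)
Lemma inner_charge_inj (k : nat) (T : set (int * int)) (h h' v : int * int)
    (s t o : bool) :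
  hole k T h -> hole k T h' ->
  inner_charge k T h v s t o -> inner_charge k T h' v s t o -> h = h'.
Proof.
move=> hh hh' [ih [i [j [-> ij sij oij]]]] [ih' [i' [j' [e ij' sij' oij']]]].
have eh := shift_pt_shift e; have eh' := shift_pt_shift (esym e).
have [E|[L|L]] : i + j = i' + j' \/ (i + j < i' + j' \/ i' + j' < i + j) by lia.
- have [{}E E'] : i - i' = 0 /\ j - j' = 0.
    by move: oij oij'; do 2 case: eqP => //; lia.
  by rewrite eh E E' [LHS](shift_ptP h h s t) !subrr !mulr0.
- have [a [b [a0 b0 ab Tu]]] := ih'.
  have := hh _ Tu; rewrite [X in dist _ X]eh' dist_shift_pt.
  by move: oij oij'; do 2 case: eqP => //; lia.
- have [a [b [a0 b0 ab Tu]]] := ih.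
  have := hh' _ Tu; rewrite [X in dist _ X]eh dist_shift_pt.
  by move: oij oij'; do 2 case: eqP => //; lia.
Qed.

(* A corner tower of [h] is interior to a quadrant of [h + (m, m)] next to
   [(s, t)] and crowds there the corner tower of [h + (m, m)]; the inner tower
   opposite to [h + (m, m)] would instead cover [h]. *)
Lemma anchored_step (k : nat) (T : set (int * int)) (h : int * int)
    (s t : bool) (m : int) :
  hole k T h -> anchored k T h s t ->
  (forall s' t', ~ crowded k T (shift_pt h s t m m) s' t') ->
  anchored k T (shift_pt h s t m m) s t -> 0 < m < k%:Z -> False.
Proof.
move=> hh [en _] nc' [_ [[e' n']|[a [b [a0 b0 ab Tu]]]]] mk.
- case: en => [e|n].
  + apply: (nc' s (~~ t)); exists (k%:Z + 1 - m), m, (k%:Z + 1), 0.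
    split; last by lia.
      split; try lia.
      by rewrite shift_ptNr shift_pt_add subrKC addrN.
    by split; try lia; rewrite shift_ptNr oppr0.
  + apply: (nc' (~~ s) t); exists m, (k%:Z + 1 - m), 0, (k%:Z + 1).
    split; last by lia.
      split; try lia.
      by rewrite shift_ptNl shift_pt_add subrKC addrN.
    by split; try lia; rewrite shift_ptNl oppr0.
- have := hh _ Tu; rewrite shift_ptNl shift_ptNr shift_pt_add.
  rewrite [X in dist _ X](shift_ptP h h s t) !subrr !mulr0 dist_shift_pt; lia.
Qed.

(** The holes differ by a diagonal shift of fewer than [k] steps, and [anchored_step] rules out a
    nonzero one. *)
Lemma corner_charge_inj (k : nat) (T : set (int * int)) (h h' v : int * int)
    (s t o : bool) :
  hole k T h -> hole k T h' ->
  corner_charge k T h v s t o -> corner_charge k T h' v s t o -> h = h'.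
Proof.
move=> hh hh' [nh ah [m mk ->]] [nh' ah' [m' mk' e]].
have eh := shift_pt_shift e; have eh' := shift_pt_shift (esym e).
have {}eh : h' = shift_pt h s t (m%:Z - m'%:Z) (m%:Z - m'%:Z).
  by rewrite eh; congr shift_pt; lia.
have {}eh' : h = shift_pt h' s t (m'%:Z - m%:Z) (m'%:Z - m%:Z).
  by rewrite eh'; congr shift_pt; lia.
case: (ltngtP m m') => [L|L|E].
- have [] := @anchored_step k T h' s t (m'%:Z - m%:Z); rewrite -?eh' //; lia.
- have [] := @anchored_step k T h s t (m%:Z - m'%:Z); rewrite -?eh //; lia.
- by rewrite eh E subrr [LHS](shift_ptP h h s t) !subrr !mulr0.
Qed.

Lemma charge_inj (k : nat) (T : set (int * int)) (h h' : int * int) x :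
  hole k T h -> hole k T h' -> charges k T h x -> charges k T h' x -> h = h'.
Proof.
move: x => [v [[[] [s t]] o]] hh hh' /=.
  exact: inner_charge_inj hh hh'.
exact: corner_charge_inj hh hh'.
Qed.

(** * Lists of charges along diagonal rays *)

Definition ray (h : int * int) (c s t o : bool) (i j : int) (n : nat) :=
  [seq (shift_pt h s t (m%:Z + i) (m%:Z + j), (c, (s, t), o)) | m <- iota 0 n].

Lemma ray_uniq (h : int * int) (c s t o : bool) (i j : int) (n : nat) :
  uniq (ray h c s t o i j n).
Proof.
rewrite map_inj_uniq ?iota_uniq // => m m' [] /(congr1 (fun x => (sgb s * (x - h.1)))).
by case: s => /=; lia.
Qed.

Lemma size_ray (h : int * int) (c s t o : bool) (i j : int) (n : nat) :
  size (ray h c s t o i j n) = n.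
Proof. by rewrite size_map size_iota. Qed.

Lemma rayP (h : int * int) (c s t o : bool) (i j : int) (n : nat) x :
  x \in ray h c s t o i j n -> exists2 m, (m < n)%N &
    x = (shift_pt h s t (m%:Z + i) (m%:Z + j), (c, (s, t), o)).
Proof. by move=> /mapP[m]; rewrite mem_iota add0n => /= mn ->; exists m. Qed.

Definition charges_at_least (k n : nat) (T : set (int * int)) (h : int * int) :
    Prop :=
  exists l, [/\ uniq l, (n <= size l)%N &
    forall x, x \in l -> charges k T h x /\ doubly k T x.1].

Lemma doubly_shift (k : nat) (T : set (int * int)) (h : int * int)
    (s t : bool) (a b a' b' i j : int) :
  T (shift_pt h s t a b) -> T (shift_pt h s t a' b') ->
  (a != a') || (b != b') ->
  `|a - i| + `|b - j| <= k%:Z -> `|a' - i| + `|b' - j| <= k%:Z ->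
  doubly k T (shift_pt h s t i j).
Proof.
move=> Tu Tu' ne le le'; exists (shift_pt h s t a b), (shift_pt h s t a' b').
rewrite !dist_shift_pt; split=> //.
by apply: contraTN ne => /eqP/shift_pt_inj[-> ->]; rewrite !eqxx.
Qed.

Lemma charges_rays (k : nat) (T : set (int * int)) (h : int * int)
    (c s t o c' s' t' o' : bool) (i j i' j' : int) (n n' : nat) :
  (c, (s, t), o) != (c', (s', t'), o') ->
  (forall m, (m < n)%N ->
    let v := shift_pt h s t (m%:Z + i) (m%:Z + j) in
    charges k T h (v, (c, (s, t), o)) /\ doubly k T v) ->
  (forall m, (m < n')%N ->
    let v := shift_pt h s' t' (m%:Z + i') (m%:Z + j') in
    charges k T h (v, (c', (s', t'), o')) /\ doubly k T v) ->
  charges_at_least k (n + n') T h.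
Proof.
move=> ne H H'.
exists (ray h c s t o i j n ++ ray h c' s' t' o' i' j' n'); split.
- rewrite cat_uniq !ray_uniq andbT /=; apply/hasPn => x /rayP[m _ ->].
  by apply: contra ne => /rayP[m' _ /(congr1 snd) /= ->].
- by rewrite size_cat !size_ray.
- by move=> x; rewrite mem_cat => /orP[] /rayP[m mn ->]; [exact: H | exact: H'].
Qed.

Lemma crowded_charges (k : nat) (T : set (int * int)) (h : int * int)
    (s t : bool) : crowded k T h s t -> charges_at_least k k T h.
Proof.
move=> [a [b [a' [b' [[a0 b0 ab Tu] [a'0 b'0 ab' Tu'] aa']]]]].
have ih : inner k T h s t by exists a, b.
(* If the second tower is a corner, the ray starts one step from [h] towards it and stays at
   distance exactly [k] from it; otherwise it starts at [(1, 1)]. *)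
pose i : int := if a' == 0 then 0 else 1.
pose j : int := if b' == 0 then 0 else 1.
rewrite -[X in charges_at_least _ X](addn0 k).
(* The second ray has length 0; its label only has to differ from the first. *)
apply: (@charges_rays _ _ _ true s t (i - j == 1) true s t (i - j != 1) i j 0 0)=> //.
- by case: (_ == 1); case: (s); case: (t).
move=> m mk /=; split.
  split=> //; exists (m%:Z + i), (m%:Z + j).
  rewrite (_ : m%:Z + i - (m%:Z + j) = i - j); last by lia.
  by split=> //; rewrite /i /j; do 2 case: eqP; lia.
apply: doubly_shift Tu Tu' _ _ _; first by rewrite aa'.
  by rewrite /i /j; do 2 case: eqP; lia.
by rewrite /i /j; do 2 case: eqP; lia.
Qed.

(* The line next to the hole meets the ball of the middle tower in
   [a + b = k + 1] points, all of them covered by one of the other two. *)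
Lemma three_inner_charges (k : nat) (T : set (int * int)) (h : int * int)
    (s t : bool) :
  inner k T h s t -> inner k T h s (~~ t) -> inner k T h (~~ s) t ->
  charges_at_least k k.+1 T h.
Proof.
move=> [a [b [a0 b0 ab Tu]]] ie ic.
have [e [f [e0 f0 ef Te]]] := ie; have [c [d [c0 d0 cd Tc]]] := ic.
(* Seen from the two neighbouring quadrants, the middle tower is [(a, - b)] or [(- a, b)]. It is at
   distance [k] from [(m + 1, m)] for [m < a], respectively from [(m, m + 1)] for [m < b]. *)
have -> : k.+1 = (`|a| + `|b|)%N by lia.
apply: (@charges_rays _ _ _ true s (~~ t) true true (~~ s) t false 1 0 0 1).
- by case: (s).
- move=> m mk /=; split.
    split=> //; exists (m%:Z + 1), (m%:Z + 0).
    by split=> //; try lia; apply/esym/eqP; lia.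
  rewrite -[t in T (shift_pt _ _ t _ _)]negbK shift_ptNr in Tu.
  by apply: doubly_shift Tu Te _ _ _; lia.
- move=> m mk /=; split.
    split=> //; exists (m%:Z + 0), (m%:Z + 1).
    by split=> //; try lia; apply/esym/negbTE/eqP; lia.
  rewrite -[s in T (shift_pt _ s _ _ _)]negbK shift_ptNl in Tu.
  by apply: doubly_shift Tu Tc _ _ _; lia.
Qed.

(* All that is used of (k + 2, 3) broadcasting: two towers at distance greater
   than [k] from [z] contribute at most 1 each to its signal. *)
Definition extra_tower (k : nat) (T : set (int * int)) : Prop :=
  forall z u1 u2, k%:Z < dist u1 z -> k%:Z < dist u2 z ->
    exists u, [/\ T u, u != u1, u != u2 & dist u z <= k%:Z + 1].

(* [w] exchanges the axes, so that the corners on both are treated together. *)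
Definition swap_pt (w : bool) (h : int * int) (s t : bool) (i j : int) :=
  if w then shift_pt h s t j i else shift_pt h s t i j.

Lemma not_crowded (k : nat) (T : set (int * int)) (h : int * int)
    (w s t : bool) (a b a' b' : int) :
  (forall s' t', ~ crowded k T h s' t') ->
  T (swap_pt w h s t a b) -> T (swap_pt w h s t a' b') ->
  a != 0 -> b != 0 -> `|a| + `|b| = k%:Z + 1 -> `|a'| + `|b'| = k%:Z + 1 ->
  (0 < a -> 0 <= a') -> (a < 0 -> a' <= 0) ->
  (0 < b -> 0 <= b') -> (b < 0 -> b' <= 0) -> a = a'.
Proof.
wlog -> : w a b a' b' / w = false => [W|].
  case: w; last exact: W.
  move=> nc Tu Tu' *.
  have : b = b' by apply: (W false b a b' a') => //; lia.
  by lia.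
rewrite /swap_pt => nc + + a0 b0 ab ab' pa na pb nb.
wlog a1 : s a a' a0 ab ab' pa na / 0 < a => [W|].
  have [/W|a1 Tu Tu'] := boolP (0 < a); first exact.
  suff : - a = - a' by lia.
  by apply: (W (~~ s)); rewrite ?shift_ptNl ?opprK //; lia.
wlog b1 : t b b' b0 ab ab' pb nb / 0 < b => [W|].
  have [/W|b1 Tu Tu'] := boolP (0 < b); first exact.
  by apply: (W (~~ t) (- b) (- b')); rewrite ?shift_ptNr ?opprK //; lia.
move=> Tu Tu'; have [//|ne] := eqVneq a a'.
by case: (nc s t); exists a, b, a', b'; do 2 (split; try lia) => //.
Qed.

Lemma far_tower (k : nat) (T : set (int * int)) (h : int * int)
    (w s t : bool) (c d : int) :
  extra_tower k T -> hole k T h -> (forall s' t', ~ crowded k T h s' t') ->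
  0 <= c -> 0 < d -> c + d = k%:Z + 1 ->
  T (swap_pt w h s t (k%:Z + 1) 0) -> T (swap_pt w h s t (- c) d) ->
  exists a b, [/\ T (swap_pt w h s t a b), `|a - b| <= k%:Z + 1
    & k%:Z + 2 <= a + b <= k%:Z + 3].
Proof.
move=> ext hh nc c0 d0 cd Te Tc.
have [||u] := ext (shift_pt h s t 1 1) (swap_pt w h s t (k%:Z + 1) 0)
                   (swap_pt w h s t (- c) d).
- by rewrite /swap_pt; case: (w); rewrite dist_shift_pt; lia.
- by rewrite /swap_pt; case: (w); rewrite dist_shift_pt; lia.
have [a [b ->]] : exists a b, u = swap_pt w h s t a b.
  rewrite /swap_pt; case: (w); last first.
    by do 2 eexists; exact: (shift_ptP h u s t).
  by do 2 eexists; exact: (shift_ptP h u s t).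
move=> [Tu /eqP u1 /eqP u2].
have {}u1 : ~ (a = k%:Z + 1 /\ b = 0) by case=> A B; apply: u1; rewrite A B.
have {}u2 : ~ (a = - c /\ b = d) by case=> A B; apply: u2; rewrite A B.
have D : dist (swap_pt w h s t a b) (shift_pt h s t 1 1) = `|a - 1| + `|b - 1|.
  by rewrite /swap_pt; case: (w); rewrite dist_shift_pt; lia.
have E : dist (swap_pt w h s t a b) h = `|a| + `|b|.
  rewrite [X in dist _ X](shift_ptP h h s t) !subrr !mulr0.
  by rewrite /swap_pt; case: (w); rewrite dist_shift_pt; lia.
rewrite D => le; have := hh _ Tu; rewrite E => gt.
exists a, b; split=> //; try lia.
apply/andP; split; last by lia.
rewrite leNgt; apply/negP => L.
(* If [a + b < k + 2], the tower lies on the sphere around [h], where it would be one of the two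
   excluded towers or make a quadrant crowded. *)
have ab : `|a| + `|b| = k%:Z + 1 by lia.
have [a0|a0] : a = 0 \/ a != 0 by lia.
  have b1 : b = k%:Z + 1 by lia.
  have c1 : c != 0 by apply/eqP => c1; apply: u2; lia.
  have : - c = a by apply: (not_crowded nc Tc Tu) => //; lia.
  by lia.
have [b0|b0] : b = 0 \/ b != 0 by lia.
  by apply: u1; lia.
have [ac|ac] : 0 < a \/ a < 0 by lia.
  have : a = k%:Z + 1 by apply: (not_crowded nc Tu Te) => //; lia.
  by lia.
have ca : a = - c by apply: (not_crowded nc Tu Tc) => //; lia.
by apply: u2; lia.
Qed.

(* The third tower near [h + (1, 1)] overlaps, along a line next to the
   diagonal of [h], either the corner tower or the tower at [(- c, d)]; in the
   second case the remaining [c] points come from the opposite quadrant. *)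
Lemma corner_charges (k : nat) (T : set (int * int)) (h : int * int)
    (w s t : bool) (c d : int) :
  extra_tower k T -> hole k T h -> (forall s' t', ~ crowded k T h s' t') ->
  0 <= c -> 0 < d -> c + d = k%:Z + 1 ->
  T (swap_pt w h s t (k%:Z + 1) 0) -> T (swap_pt w h s t (- c) d) ->
  (0 < c -> inner k T h (~~ s) (~~ t)) -> charges_at_least k k T h.
Proof.
move=> ext hh nc c0 d0 cd Te Tc opp.
have [a [b [Tu ab sab]]] := far_tower ext hh nc c0 d0 cd Te Tc.
have anc : anchored k T h s t.
  split; first by move: Te; rewrite /swap_pt; case: (w); [right|left].
  have [c1|c1] : 0 < c \/ c = 0 by lia.
    by right; exact: opp.
  left; move: Te Tc; rewrite c1 oppr0 (_ : d = k%:Z + 1); last by lia.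
  by rewrite /swap_pt; case: (w).
have [L|L] : 1 - k%:Z <= a - b \/ a - b < 1 - k%:Z by lia.
  rewrite -[X in charges_at_least _ X](addn0 k).
  apply: (@charges_rays _ _ _ false s t (~~ w) false s t w
    (1 + (~~ w)%:Z) (1 + w%:Z) 0 0) => //.
    by case: (w); case: (s); case: (t).
  move=> m mk /=; split.
    split=> //; exists m => //.
    by congr shift_pt; rewrite ?negbK; lia.
  move: Te Tu; rewrite /swap_pt; case: (w) => Te Tu /=.
    by apply: doubly_shift Te Tu _ _ _; lia.
  by apply: doubly_shift Te Tu _ _ _; lia.
(* Up to [w], the first ray consists of the points [(m + 1, m + 2)], at distance [k] from [(- c, d)]
   for [m < d - 1]. The second supplies the missing [c] points. *)
rewrite [X in charges_at_least _ X](_ : k = `|d|.-1 + `|c|)%N; last by lia.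
apply: (@charges_rays _ _ _ false s t w true (~~ s) (~~ t) (~~ w)
  (1 + w%:Z) (1 + (~~ w)%:Z) (~~ w)%:Z w%:Z) => //.
- move=> m mk /=; split.
    split=> //; exists m; first by lia.
    by congr shift_pt; lia.
  move: Tc Tu; rewrite /swap_pt; case: (w) => Tc Tu /=.
    by apply: doubly_shift Tc Tu _ _ _; lia.
  by apply: doubly_shift Tc Tu _ _ _; lia.
- move=> m mc /=; have opp' : inner k T h (~~ s) (~~ t) by apply: opp; lia.
  have [e [f [e0 f0 ef Tf]]] := opp'.
  split.
    split=> //; exists (m%:Z + (~~ w)%:Z), (m%:Z + w%:Z).
    by split=> //; case: (w) => /=; lia.
  rewrite -[s]negbK -[t]negbK /swap_pt in Tc.
  move: Tc; case: (w); rewrite shift_ptNl shift_ptNr => Tc /=.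
    by apply: doubly_shift Tc Tf _ _ _; lia.
  by apply: doubly_shift Tc Tf _ _ _; lia.
Qed.

(** [E] and [N] stand for the corners on the two axes, [I] for the open quadrants. Corners on both
    axes give the first case. Two corners on the same axis exclude all inner towers, so a lone
    corner comes with both quadrants away from it. Without corners, one of three quadrants is
    adjacent to the other two. *)
Lemma three_classes (E N : bool -> bool) (I : bool -> bool -> bool)
    (B := [:: (true, true); (true, false); (false, true); (false, false)]) :
  (forall s t, I s t -> ~~ E s && ~~ N t) ->
  (2 < E true + E false + N true + N false +
       (I true true + I true false + I false true + I false false))%N ->
  [|| has (fun b => E b.1 && N b.2) B,
      has (fun b => [&& I b.1 b.2, I b.1 (~~ b.2) & I (~~ b.1) b.2]) B,
      has (fun s => [&& E s, I (~~ s) true & I (~~ s) false]) [:: true; false]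
    | has (fun t => [&& N t, I true (~~ t) & I false (~~ t)]) [:: true; false]].
Proof.
move=> H; move: (H true true) (H true false) (H false true) (H false false) => /=.
case: (I true true); case: (I true false); case: (I false true);
case: (I false false); case: (E true); case: (E false); case: (N true);
case: (N false) => //= *;
  by do ?[match goal with H : is_true true -> _ |- _ => have := H isT => // end].
Qed.

(** The values index the list [L] in [hole_charges]: four corners, then four open quadrants. *)
Definition sphere_class (h u : int * int) : nat :=
  let a : int := u.1 - h.1 in let b : int := u.2 - h.2 in
  if b == 0 then (if 0 < a then 0%N else 1%N) else
  if a == 0 then (if 0 < b then 2%N else 3%N) else
  if 0 < a then (if 0 < b then 4%N else 5%N) else
  (if 0 < b then 6%N else 7%N).

Lemma sphere_class_inj (k : nat) (T : set (int * int)) (h u u' : int * int) :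
  (forall s' t', ~ crowded k T h s' t') -> T u -> T u' ->
  dist u h = k%:Z + 1 -> dist u' h = k%:Z + 1 ->
  sphere_class h u = sphere_class h u' -> u = u'.
Proof.
move=> nc Tu Tu'.
pose a := u.1 - h.1; pose b := u.2 - h.2.
pose a' := u'.1 - h.1; pose b' := u'.2 - h.2.
have Eu : u = swap_pt false h true true a b.
  by rewrite [LHS](shift_ptP h u true true) !mul1r.
have Eu' : u' = swap_pt false h true true a' b'.
  by rewrite [LHS](shift_ptP h u' true true) !mul1r.
rewrite {1}Eu {1}Eu' in Tu Tu' *.
rewrite /dist /sphere_class -/a -/b -/a' -/b' => d d' c.
have [E|ab] : (a = a' /\ b = b') \/ (a != 0 /\ b != 0 /\ a' != 0 /\ b' != 0).
  by clear -d d' c; move: c; do ?case: ifPn; lia.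
  by rewrite Eu Eu'; case: E => -> ->.
have [a0 [b0 [a'0 b'0]]] := ab.
have [sa sb] : (0 < a) = (0 < a') /\ (0 < b) = (0 < b').
  move: c; rewrite (negbTE a0) (negbTE b0) (negbTE a'0) (negbTE b'0).
  by case: (0 < a); case: (0 < a'); case: (0 < b); case: (0 < b').
have Ea : a = a'.
  by apply: (not_crowded nc Tu Tu') => //; clear -a0 b0 a'0 b'0 sa sb; lia.
rewrite Eu Eu' Ea (_ : b = b') //.
by clear -Ea d d' a0 b0 a'0 b'0 sb; lia.
Qed.

Lemma inner_excludes (k : nat) (T : set (int * int)) (h : int * int)
    (s t : bool) :
  (forall s' t', ~ crowded k T h s' t') -> inner k T h s t ->
  ~ T (shift_pt h s t (k%:Z + 1) 0) /\ ~ T (shift_pt h s t 0 (k%:Z + 1)).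
Proof.
move=> nc [a [b [a0 b0 ab Tu]]].
split=> Tc; apply: (nc s t).
  by exists a, b, (k%:Z + 1), 0; split; [split | split=> //; lia | lia].
by exists a, b, 0, (k%:Z + 1); split; [split | split=> //; lia | lia].
Qed.

Lemma hole_charges (k : nat) (T : set (int * int)) (h : int * int) :
  extra_tower k T -> hole k T h -> charges_at_least k k T h.
Proof.
move=> ext hh; have [[s [t]]|] := pselect (exists s t, crowded k T h s t).
  exact: crowded_charges.
move=> nc'; have {nc'} nc s t : ~ crowded k T h s t.
  by move=> C; apply: nc'; exists s, t.
(* The first tower need not avoid any other, so an arbitrary point outside the ball serves as both
   excluded points. *)
have far : k%:Z < dist (shift_pt h true true (k%:Z + 1) 0) h.
  by rewrite /dist /shift_pt /=; lia.
have [u1 [T1 _ _ d1]] := ext _ _ _ far far.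
have [u2 [T2 ne21 _ d2]] := ext _ _ _ (hh _ T1) (hh _ T1).
have [u3 [T3 ne31 ne32 d3]] := ext _ _ _ (hh _ T1) (hh _ T2).
have {}d1 : dist u1 h = k%:Z + 1 by have := hh _ T1; lia.
have {}d2 : dist u2 h = k%:Z + 1 by have := hh _ T2; lia.
have {}d3 : dist u3 h = k%:Z + 1 by have := hh _ T3; lia.
pose E s := `[< T (shift_pt h s true (k%:Z + 1) 0) >].
pose N t := `[< T (shift_pt h true t 0 (k%:Z + 1)) >].
pose I s t := `[< inner k T h s t >].
pose L := [:: E true; E false; N true; N false;
              I true true; I true false; I false true; I false false].
have inL u : T u -> dist u h = k%:Z + 1 -> 
    sphere_class h u \in [seq i <- iota 0 8 | nth false L i].
  move=> Tu du.
  have at_u s t x y : u.1 - h.1 = sgb s * x -> u.2 - h.2 = sgb t * y ->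
      T (shift_pt h s t x y).
    by rewrite /shift_pt => <- <-; rewrite !subrKC -surjective_pairing.
  move: du; rewrite /dist => du.
  rewrite mem_filter mem_iota /sphere_class /=; case: eqP => b0.
    case: ifPn => a0 /=; rewrite andbT; apply/asboolP; apply: at_u => /=; lia.
  case: eqP => a0.
    case: ifPn => b1 /=; rewrite andbT; apply/asboolP; apply: at_u => /=; lia.
  case: ifPn => a1; case: ifPn => b1 /=; rewrite andbT; apply/asboolP;
    exists `|u.1 - h.1|, `|u.2 - h.2|; split; try lia; apply: at_u => /=; lia.
have : (size [:: sphere_class h u1; sphere_class h u2; sphere_class h u3] <=
        size [seq i <- iota 0 8 | nth false L i])%N.
  apply: uniq_leq_size.
    rewrite /= !inE andbT negb_or -!andbA; apply/and3P; split.
    - by apply: contra ne21 => /eqP/(sphere_class_inj nc T1 T2 d1 d2) ->.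
    - by apply: contra ne31 => /eqP/(sphere_class_inj nc T1 T3 d1 d3) ->.
    - by apply: contra ne32 => /eqP/(sphere_class_inj nc T2 T3 d2 d3) ->.
  by move=> i; rewrite !inE => /or3P[] /eqP ->; exact: inL.
rewrite size_filter /= !addn0 => cnt.
have {}cnt : (2 < E true + E false + N true + N false +
       (I true true + I true false + I false true + I false false))%N.
  by move: cnt; rewrite !addnA.
have Ew s t : E s -> T (swap_pt false h s t (k%:Z + 1) 0).
  by move=> /asboolP; rewrite /swap_pt /shift_pt !mulr0.
have Nw s t : N t -> T (swap_pt true h s t (k%:Z + 1) 0).
  by move=> /asboolP; rewrite /swap_pt /shift_pt !mulr0.
have excl s t : I s t -> ~~ E s && ~~ N t.
  move=> /asboolP/(inner_excludes nc)[nE nN].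
  rewrite /shift_pt !mulr0 in nE nN.
  by apply/andP; split; apply/asboolP; rewrite /shift_pt mulr0.
(* In the first case the second corner plays the role of [(- c, d)] with [c = 0]; in the last two
   one inner tower does, and the other one is in the opposite quadrant. *)
case/or4P: (three_classes excl cnt) => /hasP[].
- move=> [s t] _ /= /andP[Es Nt].
  apply: (@corner_charges _ _ _ false s t 0 (k%:Z + 1)) => //; first exact: Ew.
  by rewrite oppr0; exact: (Nw s).
- move=> [s t] _ /= /and3P[/asboolP I1 /asboolP I2 /asboolP I3].
  have [l [ul sl Hl]] := three_inner_charges I1 I2 I3.
  by exists l; split=> //; exact: ltnW.
- move=> s _ /and3P[Es /asboolP[c [d [c0 d0 cd Tc]]] /asboolP Io].
  apply: (@corner_charges _ _ _ false s true c d) => //; first exact: ltW.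
    exact: Ew.
  by rewrite /swap_pt -shift_ptNl.
- move=> t _ /and3P[Nt /asboolP[d [c [d0 c0 cd Tc]]] /asboolP Io].
  apply: (@corner_charges _ _ _ true true t c d) => //; first exact: ltW.
  - by rewrite addrC.
  - exact: Nw.
  - by rewrite /swap_pt -shift_ptNr.
Qed.

(** * Counting *)

Definition grid (n : nat) : seq (int * int) :=
  [seq (i%:Z - n%:Z, j%:Z - n%:Z) | i <- iota 0 (2 * n + 1), j <- iota 0 (2 * n + 1)].

Lemma size_grid (n : nat) : size (grid n) = ((2 * n + 1) ^ 2)%N.
Proof. by rewrite size_allpairs size_iota. Qed.

Lemma grid_uniq (n : nat) : uniq (grid n).
Proof.
apply: allpairs_uniq; rewrite ?iota_uniq // => -[i j] [i' j'] _ _ /= [? ?].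
by congr pair; lia.
Qed.

Lemma mem_grid (n : nat) (v : int * int) :
  (v \in grid n) = (`|v.1| <= n%:Z) && (`|v.2| <= n%:Z).
Proof.
apply/allpairsP/andP => [[[i j] /= [+ + ->]]|].
  by rewrite !mem_iota /= => ? ?; split; lia.
case: v => x y /= [? ?]; exists (absz (x + n%:Z), absz (y + n%:Z)).
by rewrite !mem_iota /=; split; try lia; congr pair; lia.
Qed.

Definition count_towers (T : set (int * int)) (n : nat) : nat :=
  count (fun v => `[< T v >]) (grid n).

Lemma card_fset_set_box (T : set (int * int)) (n : nat) :
  #|` fset_set (T `&` box n)| = count_towers T n.
Proof.
rewrite /count_towers -size_filter; apply: perm_size.
apply: uniq_perm; rewrite ?fset_uniq ?filter_uniq ?grid_uniq // => v.
have fin : finite_set (T `&` box n) by exact: finite_setIr (finite_box n).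
rewrite in_fset_set // mem_filter mem_grid; apply/idP/andP.
  by move=> /set_mem[Tv [/= ? ?]]; split; [exact/asboolP | lia].
by move=> [/asboolP Tv ?]; apply/mem_set; split=> //; split=> /=; lia.
Qed.

Definition l1_ball (k : nat) : seq (int * int) :=
  [seq u <- grid k | `|u.1| + `|u.2| <= k%:Z].

Lemma mem_l1_ball (k : nat) (u : int * int) :
  (u \in l1_ball k) = (`|u.1| + `|u.2| <= k%:Z).
Proof. by rewrite mem_filter mem_grid; apply/andP/idP => [[]//|?]; split=> //; lia. Qed.

Lemma size_l1_ball_gt0 (k : nat) : (0 < size (l1_ball k))%N.
Proof. by rewrite -has_predT; apply/hasP; exists (0, 0); rewrite ?mem_l1_ball. Qed.

Lemma double_counting (A B : eqType) (r : A -> B -> Prop) (n : nat)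
    (s : seq A) (l : seq B) :
  uniq s ->
  (forall x, x \in s -> exists lx, [/\ uniq lx, (n <= size lx)%N &
    forall y, y \in lx -> y \in l /\ r x y]) ->
  (forall x x' y, x \in s -> x' \in s -> r x y -> r x' y -> x = x') ->
  (n * size s <= size l)%N.
Proof.
elim: s l => [|x s IH] l; first by rewrite muln0.
move=> /= /andP[xs us] H inj; have [lx [ulx nlx Hx]] := H x (mem_head x s).
rewrite mulnS -(count_predC (mem lx) l) leq_add //.
  rewrite (leq_trans nlx) // -size_filter uniq_leq_size // => y ylx.
  by rewrite mem_filter /= ylx; have [] := Hx _ ylx.
rewrite -size_filter; apply: IH => //; last first.
  by move=> x1 x2 y x1s x2s; apply: inj; rewrite inE ?x1s ?x2s orbT.
move=> x' x's; have [|l' [ul' nl' Hl']] := H x'; first by rewrite inE x's orbT.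
exists l'; split=> // y yl'; have [yl rx'y] := Hl' _ yl'; split=> //.
rewrite mem_filter yl andbT /=; apply/negP => ylx; have [_ rxy] := Hx _ ylx.
have xx' : x = x' by apply: inj rxy rx'y; rewrite inE ?eqxx ?x's ?orbT.
by move: xs; rewrite xx' x's.
Qed.

Lemma charge_near (k : nat) (T : set (int * int)) (h : int * int) x :
  charges k T h x -> `|x.1.1 - h.1| <= k%:Z + 1 /\ `|x.1.2 - h.2| <= k%:Z + 1.
Proof.
move: x => [v [[[] [s t]] o]] /=.
  move=> [_ [i [j [-> ij sij _]]]].
  by case: s; case: t; rewrite /shift_pt /sgb /=; lia.
by move=> [_ _ [m mk ->]]; case: s; case: t; rewrite /shift_pt /sgb /=; lia.
Qed.

(** Each hole makes at least [k >= 16] charges, and there are 16 labels per doubly covered point.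
    The margin [k + 1] is the reach of a charge. *)
Lemma count_holes_le (k : nat) (T : set (int * int)) (n : nat) :
  (16 <= k)%N -> extra_tower k T ->
  (count (fun v => `[< hole k T v >]) (grid n) <=
   count (fun v => `[< doubly k T v >]) (grid (n + k.+1)))%N.
Proof.
move=> k16 ext; rewrite -!size_filter -(@leq_pmul2l 16) //.
set s := seq.filter _ (grid n); set D := seq.filter _ _.
have -> : (16 * size D)%N =
    size [seq (v, x) | v <- D, x <- enum {: bool * (bool * bool) * bool}].
  by rewrite size_allpairs -cardT !card_prod card_bool mulnC.
apply: (@double_counting _ _ (charges k T)).
- by rewrite filter_uniq ?grid_uniq.
- move=> h; rewrite mem_filter mem_grid => /andP[/asboolP hh nh].
  have [l [ul sl Hl]] := hole_charges ext hh.
  exists l; split=> //; first exact: leq_trans sl.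
  move=> [v x] /Hl[cv dv]; split=> //.
  apply/allpairsP; exists (v, x); rewrite /= mem_enum mem_filter mem_grid.
  have [/= n1 n2] := charge_near cv; split=> //.
  by apply/andP; split; [exact/asboolP | lia].
- move=> h h' x; rewrite !mem_filter => /andP[/asboolP hh _] /andP[/asboolP hh' _].
  exact: charge_inj.
Qed.

(** * Covering multiplicities *)

Definition local_towers (k : nat) (T : set (int * int)) (v : int * int) : nat :=
  count (fun u => `[< T (v + u) >]) (l1_ball k).

(** The left side is the number of balls covering [v], capped at 2. *)
Lemma local_towers_ge (k : nat) (T : set (int * int)) (v : int * int) :
  (~~ `[< hole k T v >] + `[< doubly k T v >] <= local_towers k T v)%N.
Proof.
have near u : dist u v <= k%:Z -> u - v \in l1_ball k.
  by rewrite mem_l1_ball /dist.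
have [[u [u' [Tu Tu' uu' du du']]]|nd] := pselect (doubly k T v).
  have : (size [:: u - v; u' - v]%R <= local_towers k T v)%N.
    rewrite /local_towers -size_filter uniq_leq_size //=.
      by rewrite inE andbT; apply: contra uu' => /eqP/addIr ->.
    move=> w; rewrite !inE mem_filter => /orP[] /eqP ->;
      rewrite addrC subrK near // andbT;
      exact/asboolP.
  by apply: leq_trans; rewrite (leq_add (leq_b1 _) (leq_b1 _)).
rewrite (asboolF nd) addn0.
case: asboolP => //= nh; rewrite -has_count.
have [u [Tu du]] : exists u, T u /\ dist u v <= k%:Z.
  apply: contrapT => no; apply: nh => u Tu; rewrite ltNge; apply/negP => du.
  by apply: no; exists u.
by apply/hasP; exists (u - v); [exact: near | rewrite addrC subrK; exact/asboolP].
Qed.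

Lemma sum_local_towers_le (k : nat) (T : set (int * int)) (n : nat) :
  (\sum_(v <- grid n) local_towers k T v <=
   size (l1_ball k) * count_towers T (n + k))%N.
Proof.
rewrite (eq_bigr (fun v => \sum_(u <- l1_ball k) nat_of_bool `[< T (v + u)%R >])%N);
  last first.
  by move=> v _; rewrite /local_towers -sum1_count big_mkcond.
rewrite exchange_big /= mulnC -iter_addn_0 -count_predT -big_const_seq.
rewrite big_seq [X in (_ <= X)%N]big_seq; apply: leq_sum => u.
rewrite mem_l1_ball => ku; rewrite -big_mkcond sum1_count /count_towers -!size_filter.
rewrite -(size_map (fun v => v + u)) uniq_leq_size //.
  by rewrite map_inj_uniq ?filter_uniq ?grid_uniq //; exact: addIr.
move=> w /mapP[v]; rewrite mem_filter mem_grid => /andP[Tv nv] ->.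
rewrite mem_filter Tv mem_grid /=; lia.
Qed.

(** The doubly covered points in the grid enlarged by [k + 1] make up for the holes of the original
    grid; the further margin [k] contains the towers that cover them. *)
Lemma extra_tower_count (k : nat) (T : set (int * int)) (n : nat) :
  (16 <= k)%N -> extra_tower k T ->
  ((2 * n + 1) ^ 2 <= size (l1_ball k) * count_towers T (n + k.+1 + k))%N.
Proof.
move=> k16 ext; apply: leq_trans (sum_local_towers_le _ _ _).
apply: (@leq_trans (\sum_(v <- grid (n + k.+1))
    (~~ `[< hole k T v >] + `[< doubly k T v >]))%N); last first.
  by apply: leq_sum => v _; exact: local_towers_ge.
rewrite big_split /= -!(big_mkcond _ (fun=> 1%N)) !sum1_count.
rewrite -size_grid -(count_predC (fun v => `[< hole k T v >])) addnC leq_add //.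
  rewrite -!size_filter uniq_leq_size ?filter_uniq ?grid_uniq // => v.
  by rewrite !mem_filter !mem_grid /= => /andP[-> ?] /=; lia.
exact: count_holes_le.
Qed.

(** * Densities, signals and the perfect code *)

Lemma le_limn_esup (R : realType) (u v : (\bar R)^nat) :
  (forall n, (u n <= v n)%E) -> (limn_esup u <= limn_esup v)%E.
Proof.
move=> uv; rewrite /limn_esup !limf_esupE.
apply: le_ereal_inf_tmp => _ [V FV <-]; apply: ge_ereal_inf.
exists (ereal_sup (u @` V)); first by exists V.
apply: ge_ereal_sup => _ [n Vn <-]; apply: le_ereal_sup_tmp.
by exists (v n) => //; exists n.
Qed.

Lemma limn_esup_perturbed (R : realType) (a c : R) :
  limn_esup (fun n => (a * (1 + c * harmonic n))%:E) = a%:E.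
Proof.
apply: (cvg_limn_einf_sup _).2; apply: cvg_EFin; first exact: nearW.
have : (fun n => a * (1 + c * @harmonic R n)) @ \oo --> a * (1 + c * 0).
  apply: cvgM; first exact: cvg_cst.
  apply: cvgD; first exact: cvg_cst.
  by apply: cvgM; [exact: cvg_cst | exact: cvg_harmonic].
by rewrite mulr0 addr0 mulr1.
Qed.

Lemma density_ge (R : realType) (T : set (int * int)) (b s : nat) :
  (0 < b)%N -> (forall n, (2 * n + 1) ^ 2 <= b * count_towers T (n + s))%N ->
  ((b%:R^-1 : R)%:E <= density R T)%E.
Proof.
move=> b0 H; rewrite -(limn_esup_perturbed _ (- (4 * s)%:R)).
apply: le_limn_esup => n; rewrite lee_fin card_fset_set_box /= /harmonic.
have n0 : 0 < (n.+1%:R : R) by rewrite ltr0n.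
have m0 : 0 < (((2 * n + 1) ^ 2)%:R : R) by rewrite ltr0n expn_gt0 addn1.
have b0' : 0 < (b%:R : R) by rewrite ltr0n.
rewrite ler_pdivlMr // -(ler_pM2l b0') !mulrA divff ?gt_eqF // mul1r.
rewrite -(ler_pM2r n0) -[X in X <= _]mulrA [X in _ * X]mulrC mulrA mulrDl mul1r.
rewrite mulNr mulNr divfK ?gt_eqF // mulrBl -!natrM lerBlDr -natrD ler_nat.
case: (leqP s n) => sn; last by nia.
have := H (n - s)%N; rewrite subnK // => {}H.
(* The squares differ by at most [4 * s * (2 * n + 1)], and [n + 1 <= 2 * n + 1]. *)
have : ((2 * n + 1) ^ 2 * n.+1 <=
    (2 * (n - s) + 1) ^ 2 * n.+1 + 4 * s * (2 * n + 1) ^ 2)%N.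
  by nia.
by nia.
Qed.

Lemma density_le (R : realType) (T : set (int * int)) (b k : nat) :
  (0 < b)%N -> (forall n, b * count_towers T n <= (2 * (n + k) + 1) ^ 2)%N ->
  (density R T <= (b%:R^-1 : R)%:E)%E.
Proof.
move=> b0 H; rewrite -(limn_esup_perturbed _ (4 * k + 4 * k ^ 2)%:R).
apply: le_limn_esup => n; rewrite lee_fin card_fset_set_box /= /harmonic.
have n0 : 0 < (n.+1%:R : R) by rewrite ltr0n.
have m0 : 0 < (((2 * n + 1) ^ 2)%:R : R) by rewrite ltr0n expn_gt0 addn1.
have b0' : 0 < (b%:R : R) by rewrite ltr0n.
rewrite ler_pdivrMr // -(ler_pM2l b0') !mulrA divff ?gt_eqF // mul1r.
rewrite -(ler_pM2r n0) -[X in _ <= X]mulrA [X in _ <= _ * X]mulrC mulrA mulrDl mul1r.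
rewrite divfK ?gt_eqF // mulrDl -!natrM -natrD ler_nat.
have := H n.
have : ((2 * (n + k) + 1) ^ 2 * n.+1 <=
  n.+1 * (2 * n + 1) ^ 2 + (4 * k + 4 * k ^ 2) * (2 * n + 1) ^ 2)%N by nia.
by nia.
Qed.

(** * Signals and covering by balls *)

Lemma finite_ball (v : int * int) (n : nat) :
  finite_set [set u | dist u v <= n%:Z].
Proof.
apply: sub_finite_set (finite_box (n + absz v.1 + absz v.2)).
by move=> [x y]; case: v => a b; rewrite /dist /box /=; lia.
Qed.

Lemma signalE (t : nat) (T : set (int * int)) (v : int * int) :
  signal t T v = \sum_(u <- fset_set (T `&` [set u | dist u v <= t%:Z]))
    Num.max 0 (t%:Z - dist u v).
Proof.
rewrite -fsbig_finite; last exact: finite_setIr (finite_ball v t).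
apply/esym; apply: fsbig_widen; first exact: subIsetl.
by move=> u [Tu /= nu]; apply/max_l; apply: contra_notT nu => ?; split=> //; lia.
Qed.

Lemma signal_ge (t : nat) (T : set (int * int)) (v : int * int)
    (s : seq (int * int)) :
  uniq s -> (forall u, u \in s -> T u) ->
  \sum_(u <- s) Num.max 0 (t%:Z - dist u v) <= signal t T v.
Proof.
move=> us sT; rewrite signalE; set S := fset_set _.
have memS u : u \in s -> (u \in S) = (dist u v <= t%:Z).
  move=> /sT Tu; rewrite in_fset_set; last exact: finite_setIr (finite_ball v t).
  by apply/idP/idP => [/set_mem[]//|le]; apply/mem_set.
have -> : \sum_(u <- s) Num.max 0 (t%:Z - dist u v) =
          \sum_(u <- S | u \in s) Num.max 0 (t%:Z - dist u v).
  rewrite -[RHS]big_filter; transitivity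
    (\sum_(u <- [seq u <- s | u \in S]) Num.max 0 (t%:Z - dist u v)).
    rewrite big_filter [RHS]big_mkcond big_seq [RHS]big_seq.
    by apply: eq_bigr => u us'; rewrite memS //; case: ifPn => //; lia.
  apply: perm_big; apply: uniq_perm; rewrite ?filter_uniq ?fset_uniq // => u.
  by rewrite !mem_filter andbC.
rewrite big_mkcond; apply: ler_sum => u _.
by case: ifP => // _; rewrite le_max lexx.
Qed.

Lemma sum_eq_le1 (T : eqType) (s : seq T) (x : T) :
  uniq s -> \sum_(u <- s) (u == x)%:Z <= 1.
Proof.
move=> us; under eq_bigr do rewrite -natz.
rewrite -natr_sum natz -big_mkcond sum1_count /=.
by rewrite count_uniq_mem //; case: (_ \in _).
Qed.

(** Otherwise [u1] and [u2] contribute at most 1 each to the signal at [z] and all other towers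
    nothing, which falls short of 3. *)
Lemma broadcasting3_extra_tower (k : nat) (T : set (int * int)) :
  broadcasting k.+2 3 T -> extra_tower k T.
Proof.
move=> bT z u1 u2 d1 d2; apply: contrapT => no; have := bT z; rewrite signalE.
set S := fset_set _ => H.
have : \sum_(u <- S) Num.max 0 (k.+2%:Z - dist u z) <=
       \sum_(u <- S) ((u == u1)%:Z + (u == u2)%:Z).
  rewrite big_seq [X in _ <= X]big_seq; apply: ler_sum => u.
  rewrite in_fset_set; last exact: finite_setIr (finite_ball z _).
  move=> /set_mem[Tu _]; case: eqVneq => [->|ne1]; first by case: eqP; lia.
  case: eqVneq => [->|ne2]; first by lia.
  by case: (lerP (dist u z) (k%:Z + 1)) => [le|]; [case: no; exists u | lia].
move=> /(le_trans H); rewrite big_split /= => /le_trans.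
by move=> /(_ _ (lerD (sum_eq_le1 u1 (fset_uniq S)) (sum_eq_le1 u2 (fset_uniq S)))).
Qed.

Lemma broadcasting1P (k : nat) (T : set (int * int)) :
  broadcasting k.+1 1 T <-> forall v, exists2 u, T u & dist u v <= k%:Z.
Proof.
split=> [bT v|H v].
  apply: contrapT => no; have := bT v; rewrite /signal fsbig1 // => u Tu.
  by case: (lerP (dist u v) k%:Z) => [le|]; [case: no; exists u | lia].
have [u Tu du] := H v; apply: le_trans (signal_ge _ _ (s := [:: u]) _ _) => //.
  by rewrite big_seq1; lia.
by move=> w; rewrite inE => /eqP ->.
Qed.

Lemma broadcasting13 (k : nat) (T : set (int * int)) :
  broadcasting k.+1 1 T -> broadcasting k.+2 3 T.
Proof.
move=> /broadcasting1P H v; have [u Tu du] := H v.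
move: (du); rewrite le_eqVlt orbC => /orP[L|/eqP L].
  apply: le_trans (signal_ge _ _ (s := [:: u]) _ _) => //.
    by rewrite big_seq1; lia.
  by move=> w; rewrite inE => /eqP ->.
pose v' : int * int := (v.1 + (if v.1 < u.1 then -1 else 1), v.2).
have d' : dist u v' = k%:Z + 1 by move: L; rewrite /dist /v' /=; case: ifP; lia.
have [w Tw dw] := H v'.
have dwv : dist w v <= k%:Z + 1.
  by move: dw; rewrite /dist /v' /=; case: ifP; lia.
apply: le_trans (signal_ge _ _ (s := [:: u; w]) _ _) => //.
- by rewrite big_cons big_seq1; lia.
- by rewrite /= inE andbT; apply: contraTN isT => /eqP uw; move: dw; rewrite -uw; lia.
- by move=> x; rewrite !inE => /orP[] /eqP ->.
Qed.

(** The lattice generated by [(k + 1, - k)] and [(k, k + 1)], written as the kernel of a residue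
    map; its index is the number of points of a ball of radius [k]. *)
Definition perfect_code (k : nat) : set (int * int) :=
  [set u | exists j : int, k%:Z * u.1 + (k%:Z + 1) * u.2 =
                           j * (2 * k%:Z ^+ 2 + 2 * k%:Z + 1)].

(* In the coordinates [p = x + y], [q = x - y] the ball is the square
   [|p|, |q| <= k] and [2 (k x + (k + 1) y) = (2 k + 1) p - q], so writing a
   residue in this form is a division with centered remainder by [2 k + 1]. *)
Lemma perfect_code_cover (k : nat) (v : int * int) :
  exists2 u, perfect_code k u & dist u v <= k%:Z.
Proof.
pose K := k%:Z; have K0 : 0 <= K by [].
pose M := 2 * K ^+ 2 + 2 * K + 1; pose c := K ^+ 2 + K.
(* Adding [c], half of [M - 1], centres the residue [r] between [- c] and [c]. *)
pose s := K * v.1 + (K + 1) * v.2 + c.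
have M0 : 0 < M by rewrite /M ltr_wpDl // addr_ge0 ?mulr_ge0 ?sqr_ge0.
pose r := (s %% M)%Z - c.
have /andP[r0 r1] : - c <= r <= c.
  have := modz_ge0 s (lt0r_neq0 M0); have := ltz_pmod s M0.
  by rewrite /r /M /c; lia.
pose m := 2 * K + 1; have m0 : 0 < m by rewrite /m; lia.
pose p := ((2 * r + K) %/ m)%Z; pose q := ((2 * r + K) %% m)%Z.
have E : 2 * r + K = p * m + q := divz_eq (2 * r + K) m.
have q0 : 0 <= q := modz_ge0 (2 * r + K) (lt0r_neq0 m0).
have q1 : q < m := ltz_pmod (2 * r + K) m0.
(* The difference of [v] and this point has residue [r], coordinate sum [p] and coordinate
   difference [K - q]. *)
exists (v.1 - ((K + 1) * p - r), v.2 - (r - K * p)).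
  exists (s %/ M)%Z; rewrite /= -/K -/M.
  have -> : (s %/ M)%Z * M = s - (s %% M)%Z by rewrite {2}(divz_eq s M) addrK.
  by rewrite (_ : (s %% M)%Z = r + c) /s; [ring | rewrite /r; ring].
have p1 : p < K + 1.
  by rewrite -(ltr_pM2r m0); move: E r1 q0; rewrite /c /m; clear; lia.
have p0 : - (K + 1) < p.
  by rewrite -(ltr_pM2r m0); move: E r0 q1; rewrite /c /m; clear; lia.
have D : 2 * r = (2 * K + 1) * p + q - K by move: E; rewrite /m; clear; lia.
rewrite /m in q1; rewrite /dist /= -/K; clear -K0 q0 q1 p0 p1 D.
by clearbody p q r K; clear -K0 q0 q1 p0 p1 D; lia.
Qed.

(** On a difference of norm at most [2 * k] the defining form is at most [2 * k * (k + 1)] in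
    absolute value, less than the modulus, hence 0. The difference is then a multiple of
    [(k + 1, - k)], a vector of norm [2 * k + 1]. *)
Lemma perfect_code_packing (k : nat) (u u' : int * int) :
  perfect_code k u -> perfect_code k u' -> dist u u' <= 2 * k%:Z -> u = u'.
Proof.
case: u u' => [x y] [x' y'] [j /= E] [j' /= E']; rewrite /dist /= => d.
move: E E' d; set K := k%:Z => E E' d; have K0 : 0 <= K by [].
pose a := x - x'; pose b := y - y'; pose i := j - j'.
have {E E'} E : K * a + (K + 1) * b = i * (2 * K ^+ 2 + 2 * K + 1).
  by rewrite /a /b /i mulrBl -E -E'; ring.
have i0 : i = 0.
  have : `|i| * (2 * K ^+ 2 + 2 * K + 1) < 1 * (2 * K ^+ 2 + 2 * K + 1).
    have M0 : 0 <= 2 * K ^+ 2 + 2 * K + 1.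
      by rewrite !addr_ge0 ?mulr_ge0 ?sqr_ge0.
    rewrite -{1}(ger0_norm M0) -normrM -E (le_lt_trans (ler_normD _ _)) //.
    rewrite !normrM (ger0_norm K0) (@ger0_norm _ (K + 1)) ?addr_ge0 //.
    have := ler_wpM2l K0 d; rewrite -/a -/b; nia.
  by rewrite ltr_pM2r; [lia | rewrite ltr_wpDl // addr_ge0 ?mulr_ge0 ?sqr_ge0].
have {E i i0} E : b = - (K * (a + b)) by move: E; rewrite i0 mul0r; lia.
have : a + b = 0.
  have F : a = (K + 1) * (a + b) by rewrite mulrDl mul1r; lia.
  move: d; rewrite -/a -/b {1}F {2}E normrN !normrM (ger0_norm K0).
  by rewrite (@ger0_norm _ (K + 1)) ?addr_ge0 //; clear -K0; nia.
by move=> ab; move: E; rewrite ab mulr0 oppr0 => b0; congr pair; lia.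
Qed.

(** The balls around the code points of the grid are disjoint and lie in the grid enlarged by
    [k]. *)
Lemma perfect_code_count (k n : nat) :
  (size (l1_ball k) * count_towers (perfect_code k) n <= (2 * (n + k) + 1) ^ 2)%N.
Proof.
rewrite -size_grid /count_towers -size_filter.
set W := seq.filter _ _.
rewrite -(size_allpairs (fun u w : int * int => w - u)) uniq_leq_size //.
  apply: allpairs_uniq; rewrite ?filter_uniq ?grid_uniq //.
  move=> _ _ /allpairsP[[u w] [/= ub wW ->]] /allpairsP[[u' w'] [/= ub' wW' ->]] /= e.
  move: ub ub' wW wW'; rewrite !mem_l1_ball !mem_filter.
  move=> ub ub' /andP[/asboolP cw _] /andP[/asboolP cw' _].
  have ww : w = w'.
    apply: (@perfect_code_packing k _ _ cw cw').
    by case: e; rewrite /dist; case: u u' ub ub' => [? ?] [? ?] /=; lia.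
  by congr pair => //; apply: oppr_inj; apply: (addrI w); rewrite e ww.
move=> v /allpairsP[[u w] [/= + + ->]]; rewrite mem_l1_ball mem_filter !mem_grid.
by move=> ub /andP[_ /andP[? ?]] /=; lia.
Qed.

Theorem theorem1 (R : realType) (t : nat) (ht : (17 < t)%N) :
  exists d : \bar R, is_delta t 3 d /\ is_delta (t - 1)%N 1 d.
Proof.
have [k kt k16] : exists2 k, t = k.+2 & (16 <= k)%N by exists (t - 2)%N; lia.
rewrite kt subn1 /=.
pose b := size (l1_ball k); have b0 : (0 < b)%N := size_l1_ball_gt0 k.
have lower T : broadcasting k.+2 3 T -> ((b%:R^-1 : R)%:E <= density R T)%E.
  move=> /broadcasting3_extra_tower ext.
  apply: (@density_ge _ _ _ (k.+1 + k)) => // n; rewrite addnA.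
  exact: extra_tower_count.
have code1 : broadcasting k.+1 1 (perfect_code k).
  exact/broadcasting1P/perfect_code_cover.
have code3 := broadcasting13 code1.
have codeE : density R (perfect_code k) = (b%:R^-1 : R)%:E.
  apply/eqP; rewrite eq_le lower // andbT.
  by apply: (@density_le _ _ _ k) => // n; exact: perfect_code_count.
exists (b%:R^-1)%:E; split; split.
- by exists (perfect_code k).
- exact: lower.
- by exists (perfect_code k).
- by move=> T /broadcasting13; exact: lower.
Qed.
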